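(* Let $q$ be a prime power, let $m$ be a positive integer relatively prime to $q$, and let $k$ be an integer with $1<k<\sigma_0(m)$, where $\sigma_0(m)$ denotes the number of positive divisors of $m$. Let $\mathbf d=(d_1,\ldots,d_k)\in\lambda_k(m)$, let $\mathbf a=(a_1,\ldots,a_k)\in\mathbb F_{\mathbf d}$ be a normal $\mathbf d$-admissible $k$-tuple, and put $D=d_1+\cdots+d_k$. Then there exists an element $\alpha\in\mathbb F_{q^m}$ that is primitive and normal over $\mathbb F_q$ and satisfies $\operatorname{Tr}_{m/d_i}(\alpha)=a_i$ for every $1\le i\le k$, provided that $$q^{m/2-\lambda(\mathbf d)-D}\ \ge\ W(q^m-1)\cdot W(x^m-1).$$
   Context: For a prime power $q$, $\mathbb F_q$ is the finite field with $q$ elements, and all fields $\mathbb F_{q^d}$ with $d\mid m$ are regarded as subfields of $\mathbb F_{q^m}$. For $d\mid n$ and $\alpha\in\mathbb F_{q^n}$, $\operatorname{Tr}_{n/d}(\alpha)=\sum_{i=0}^{n/d-1}\alpha^{q^{id}}\in\mathbb F_{q^d}$. An element of $\mathbb F_{q^m}$ is primitive if it generates the cyclic group $\mathbb F_{q^m}^*$. An element $\alpha\in\mathbb F_{q^n}$ is normal over $\mathbb F_q$ (as an element of $\mathbb F_{q^n}$) if $\{\alpha,\alpha^q,\ldots,\alpha^{q^{n-1}}\}$ is a basis of $\mathbb F_{q^n}$ over $\mathbb F_q$. $\lambda_k(m)$ is the set of $k$-tuples $\mathbf d=(d_1,\ldots,d_k)$ where $d_1<\cdots<d_k<m$ are positive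 divisors of $m$ such that $d_i\nmid d_j$ for all $1\le i<j\le k$. For such $\mathbf d$, $\mathbb F_{\mathbf d}=\prod_{i=1}^k\mathbb F_{q^{d_i}}$ and $$\lambda(\mathbf d)=d_1+\cdots+d_k+\sum_{i=2}^{k}(-1)^{i+1}\sum_{1\le l_1<\cdots<l_i\le k}\gcd(d_{l_1},\ldots,d_{l_i}),$$ which equals $\deg(\operatorname{lcm}(x^{d_1}-1,\ldots,x^{d_k}-1))$. A $k$-tuple $\mathbf a=(a_1,\ldots,a_k)\in\mathbb F_{\mathbf d}$ is $\mathbf d$-admissible if for all $1\le i<j\le k$, $\operatorname{Tr}_{d_i/\gcd(d_i,d_j)}(a_i)=\operatorname{Tr}_{d_j/\gcd(d_i,d_j)}(a_j)$. A $\mathbf d$-admissible $\mathbf a$ is normal if, for every $i$, $a_i$ is normal over $\mathbb F_q$ as an element of $\mathbb F_{q^{d_i}}$. For a positive integer $n$, $W(n)$ is the number of square-free positive divisors of $n$; for a nonzero $f\in\mathbb F_q[x]$, $W(f)$ is the number of monic square-free divisors of $f$ in $\mathbb F_q[x]$. *)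

(* Defs.v *)
From HB Require Import structures.
From mathcomp Require Import all_boot all_order all_fingroup all_algebra.
From mathcomp Require Import all_solvable all_field.
From mathcomp Require Import reals exp.

Set Implicit Arguments.
Unset Strict Implicit.
Unset Printing Implicit Defensive.

Import Order.TTheory GRing.Theory Num.Theory.
Local Open Scope ring_scope.

(* A square divisor e ^ 2 of n > 0 has e \in divisors n, so testing the
   divisors suffices. *)
Definition squarefree (n : nat) : bool :=
  (0 < n)%N && all (fun e => (e ^ 2 %| n)%N ==> (e == 1%N)) (divisors n).

Definition Wnat (n : nat) : nat := count squarefree (divisors n).

(* h ranges over the polynomials of degree < size g, i.e. at most deg g. *)
Definition squarefree_poly (F : finFieldType) (g : {poly F}) : bool :=
  [forall h : {poly_(size g) F}, ((h : {poly F}) ^+ 2 %| g) ==>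
                                 (size (h : {poly F}) == 1%N)].

(* A divisor of f != 0 has size at most size f. *)
Definition Wpoly (F : finFieldType) (f : {poly F}) : nat :=
  #|[pred g : {poly_(size f) F} | [&& (g : {poly F}) \is monic,
       squarefree_poly (g : {poly F}) & (g : {poly F}) %| f]]|.

(* Tr_{n/d} from the field with q ^ n elements to the one with q ^ d. *)
Definition trace (L : fieldType) (q n d : nat) (x : L) : L :=
  \sum_(i < n %/ d) x ^+ (q ^ (i * d)).

(* finvect_type L is L itself, with its finite field structure. *)
Definition primitive_elt (F : finFieldType) (L : fieldExtType F) (x : L) :
    Prop :=
  exists2 u : {unit finvect_type L},
    val u = x & generator [set: {unit finvect_type L}] u.

(* x is normal over F as an element of the intermediate field K. *)
Definition normal_elt (F : finFieldType) (L : fieldExtType F)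
    (K : {subfield L}) (x : L) : Prop :=
  basis_of K [seq x ^+ (#|F| ^ j) | j <- iota 0 (\dim K)].

(* d \in lambda_k(m) *)
Definition lambda_tuples (k m : nat) (d : 'I_k -> nat) : Prop :=
  [/\ forall i, (0 < d i)%N /\ (d i %| m)%N,
      forall i, (d i < m)%N,
      forall i j : 'I_k, (i < j)%N -> (d i < d j)%N
    & forall i j : 'I_k, (i < j)%N -> ~~ (d i %| d j)%N].

(* An increasing choice l_1 < ... < l_i of indices is a set of i indices. *)
Definition lambda_deg (k : nat) (d : 'I_k -> nat) : int :=
  (\sum_(i < k) d i)%N%:Z +
  \sum_(2 <= i < k.+1) (-1) ^+ i.+1 *
     \sum_(l : {set 'I_k} | #|l| == i) (\big[gcdn/0%N]_(j in l) d j)%:Z.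

Definition admissible (L : fieldType) (q k : nat) (d : 'I_k -> nat)
    (a : 'I_k -> L) : Prop :=
  forall i j : 'I_k, (i < j)%N ->
    trace q (d i) (gcdn (d i) (d j)) (a i) =
    trace q (d j) (gcdn (d i) (d j)) (a j).

(* Main.v *)
Require Import Defs.
From HB Require Import structures.
From mathcomp Require Import all_boot all_order all_fingroup all_algebra.
From mathcomp Require Import all_solvable all_field all_character.
From mathcomp Require Import reals exp.
From mathcomp Require Import ring zify.

Set Implicit Arguments.
Unset Strict Implicit.
Unset Printing Implicit Defensive.

Import Order.TTheory GRing.Theory Num.Theory.
Local Open Scope ring_scope.

(** The proof is a sieve carried out at the same time in the additive and in
    the multiplicative group of the field [L] with [q ^ m] elements.  Let [D]
    be the sum of the [d i] and [V] the common kernel of the trace maps from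
    [L] to the fields [K i]; its codimension is at most [D].

    The elements with the prescribed traces form a coset of [V].  The coset is
    not empty because the traces, divided by their degrees ([average] below),
    are commuting projections, so a simultaneous solution can be built one
    trace at a time ([prescribed_traces_exist]).  Through [frob_act] the field
    is a module over the polynomials, [X] acting as the Frobenius map, and
    [x] is normal exactly when no [(X^m - 1) / p], with [p] an irreducible
    factor of [X^m - 1], annihilates [x].  For an element of the coset this
    has to be asked only of the [p] dividing no [X^(d i) - 1]: the other
    conditions follow from the normality of the [a i].  An element of the
    cyclic group of units is primitive when it avoids the kernels of the maps
    [u -> u^(n / p)], for [n = q ^ m - 1] and [p] a prime factor of [n].

    Hence both conditions say that an element avoids finitely many subgroups
    of an abelian group, and these subgroups are independent.  The indicator
    function of such a set has a known sum, the density [theta] times the size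
    of the ambient set, and its Fourier coefficients have l1-norm at most
    [2 ^ r * theta] for [r] subgroups ([product_sieve]).  The same [theta]
    occurs in both statements, so it cancels in the end.  The two Fourier
    expansions are played against each other by the Gauss sum estimate: if
    [w] is the additive weight and [v] the multiplicative one, the sum of
    [w u * v u] differs from the sum of [w] times the mean of [v] by at most
    the product of the two l1-norms times [sqrt (q ^ m)]
    ([sum_mixed_weights]).  It is nonzero as soon as the size [t] of [V]
    exceeds [2 ^ r1 * 2 ^ r2 * sqrt (q ^ m)], with [r1] the number of prime
    factors of [q ^ m - 1] and [r2] that of irreducible factors of [X^m - 1].
    These powers of two are at most the two numbers [W], by counting the
    products of distinct prime factors, and [t * q ^ D >= q ^ m].  So the
    hypothesis suffices once [lambda_deg d >= 1] is known: the exponent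
    [m / 2 - D] exceeds the one in the hypothesis by at least 1, which makes
    the inequality strict. *)

(** * Fourier multipliers and sieves on finite abelian groups *)

Section Multipliers.

Variable gT : finGroupType.
Hypothesis abG : abelian [set: gT].

Definition char_bounded (B : algC) (w : gT -> algC) : Prop :=
  forall psi : 'CF([set: gT]), psi \is a linear_char ->
    `|\sum_x w x * psi x| <= B.

(** A dual form of the l1-norm of the Fourier transform: [f] is a multiplier
    with constant [N] if multiplying a weight by [f] enlarges the largest
    Fourier coefficient of the weight at most [N] times.  In this form the
    estimate for a product is just composition. *)
Definition multiplier (N : algC) (f : gT -> algC) : Prop :=
  forall w B, char_bounded B w -> char_bounded (N * B) (fun x => w x * f x).

Lemma multiplierM N1 N2 f g :
  multiplier N1 f -> multiplier N2 g ->
  multiplier (N1 * N2) (fun x => f x * g x).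
Proof.
move=> mf mg w B wB psi psiL.
rewrite (mulrC N1) -mulrA; under eq_bigr do rewrite mulrA.
by apply: (mg (fun x => w x * f x)) => //; apply: mf.
Qed.

Lemma multiplier_ge0 N f : multiplier N f -> 0 <= N.
Proof.
move=> mf; have b1: char_bounded 1 (fun x => (x == 1%g)%:R).
  move=> psi psiL; rewrite (bigD1 1%g) //= eqxx mul1r big1 ?addr0.
    by rewrite lin_char1 ?normr1.
  by move=> x /negPf ->; rewrite mul0r.
rewrite -[N]mulr1; apply: le_trans (mf _ _ b1 1 (rpred1 _)); exact: normr_ge0.
Qed.

Lemma abelian_irr_lin (i : Iirr [set: gT]) : 'chi_i \is a linear_char.
Proof. by move/char_abelianP: abG; apply. Qed.

(** The link with Fourier expansions: multiplying by a linear character only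
    permutes the linear characters, so each term of the expansion contributes
    the absolute value of its coefficient. *)
Lemma multiplier_irr_sum (c : Iirr [set: gT] -> algC) f N :
    (forall x, f x = \sum_i c i * 'chi_i x) -> \sum_i `|c i| <= N ->
  multiplier N f.
Proof.
move=> fE cN w B wB psi psiL.
have B_ge0: 0 <= B by apply: le_trans (wB psi psiL).
have ->: \sum_x w x * f x * psi x =
         \sum_i c i * \sum_x w x * ('chi_i * psi) x.
  under [RHS]eq_bigr do rewrite mulr_sumr.
  rewrite exchange_big /=; apply: eq_bigr => x _.
  rewrite fE mulr_sumr mulr_suml; apply: eq_bigr => i _.
  by rewrite cfunE mulrCA !mulrA.
apply: (le_trans (ler_norm_sum _ _ _)).
apply: (@le_trans _ _ (\sum_i `|c i| * B)); last first.
  by rewrite -mulr_suml ler_wpM2r.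
apply: ler_sum => i _; rewrite normrM ler_wpM2l //.
by apply: wB; rewrite rpredM ?abelian_irr_lin.
Qed.

(** Since [U] supplements [H], it meets every coset of [H]; each intersection
    is a coset of [U :&: H]. *)
Lemma card_supplement_translate (U H : {group gT}) x :
  (U * H)%g = [set: gT] -> #|[set u in U | (x * u)%g \in H]| = #|U :&: H|.
Proof.
move=> UH; have: (x^-1)%g \in (U * H)%g by rewrite UH inE.
case/mulsgP=> u0 h0 u0U h0H xE.
rewrite -(card_lcoset (U :&: H) u0); apply: eq_card => u.
have xV: x = (h0^-1 * u0^-1)%g by rewrite -invMg -xE invgK.
rewrite inE mem_lcoset inE (groupMl u (groupVr u0U)) xV -mulgA.
by rewrite (groupMl _ (groupVr h0H)).
Qed.

(** Independence: averaging over the translates by [U], which leave [f]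
    unchanged, spreads [H] evenly over the group. *)
Lemma sum_supplement (U H : {group gT}) (f : gT -> algC) :
    (U * H)%g = [set: gT] ->
    (forall x u, u \in U -> f (x * u)%g = f x) ->
  \sum_x f x * (x \in H)%:R = (\sum_x f x) / #|[set: gT] : H|%g%:R.
Proof.
move=> UH fU.
have Q_neq0: #|[set: gT] : H|%g%:R != 0 :> algC by rewrite pnatr_eq0 -lt0n.
have U_neq0: #|U|%:R != 0 :> algC by rewrite pnatr_eq0 -lt0n cardG_gt0.
have UHQ: (#|U :&: H| * #|[set: gT] : H|%g = #|U|)%N.
  have := mul_cardG U H; rewrite UH -(Lagrange (subsetT H)) => e.
  by apply/eqP; rewrite -(eqn_pmul2r (cardG_gt0 H)) e; apply/eqP; ring.
apply: (canRL (mulfK Q_neq0)); apply: (mulfI U_neq0).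
have translate u : u \in U ->
    \sum_x f x * (x \in H)%:R = \sum_x f x * ((x * u)%g \in H)%:R.
  move=> uU; rewrite (reindex_inj (mulIg u)) /=.
  by apply: eq_bigr => x _; rewrite fU.
have avg: #|U|%:R * (\sum_x f x * (x \in H)%:R) =
          #|U :&: H|%:R * \sum_x f x.
  rewrite mulr_natl -sumr_const (eq_bigr _ translate) exchange_big mulr_sumr /=.
  apply: eq_bigr => x _; rewrite -mulr_sumr mulrC; congr (_ * _).
  rewrite -(card_supplement_translate x UH) -sum1_card natr_sum [RHS]big_mkcond.
  rewrite [LHS]big_mkcond; apply: eq_bigr => u _; rewrite inE.
  by case: (u \in U); case: (_ \in H).
by rewrite mulrA avg mulrAC -natrM UHQ.
Qed.

Section SubgroupIndicator.

Variable H : {group gT}.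
Let Q : algC := #|[set: gT] : H|%g%:R.
Let c (i : Iirr [set: gT]) := '['1_H, 'chi_i].

Let nHG : (H <| [set: gT])%g.
Proof. by rewrite -(sub_abelian_normal _ abG) ?subsetT. Qed.

Let indicatorE x : (x \in H)%:R = \sum_i c i * 'chi_i x.
Proof.
rewrite -(cfuniE x nHG) [in LHS](cfun_sum_cfdot '1_H) sum_cfunE.
by apply: eq_bigr => i _; rewrite cfunE.
Qed.

(** The indicator of [H] is positive definite, being [Q^-1] times a character,
    namely the one induced from the trivial character of [H].  So the l1-norm
    of its coefficients is its value at the identity. *)
Let c_ge0 i : 0 <= c i.
Proof.
have Q_gt0: 0 < Q by rewrite ltr0n.
suff: 0 <= Q * c i by rewrite pmulr_rge0.
rewrite -cfdotZl -cfInd_cfun1 //.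
by rewrite natr_ge0 // Cnat_cfdot_char ?irr_char // cfInd_char ?rpred1.
Qed.

Let c_sum : \sum_i c i = 1.
Proof.
have := indicatorE 1%g; rewrite group1 mulr1n => ->.
by apply: eq_bigr => i _; rewrite lin_char1 ?mulr1 ?abelian_irr_lin.
Qed.

Let c0 : c 0 = Q^-1.
Proof.
rewrite /c irr0 -cfuniG cfdot_cfuni // setIT /Q.
rewrite -[X in _ / X%:R](Lagrange (subsetT H)) natrM invfM mulrA divff ?mul1r //.
by rewrite pnatr_eq0 -lt0n cardG_gt0.
Qed.

(** A translation multiplies each Fourier coefficient by a number of absolute
    value 1. *)
Lemma multiplier_coset y :
  multiplier 1 (fun x => (x * y^-1 \in H)%g%:R).
Proof.
apply: (@multiplier_irr_sum (fun i => c i * 'chi_i y^-1%g)) => [x|].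
  rewrite indicatorE; apply: eq_bigr => i _.
  by rewrite (lin_charM (abelian_irr_lin i)) ?inE // mulrA mulrAC.
rewrite -c_sum; apply: ler_sum => i _.
by rewrite normrM normC_lin_char ?inE ?abelian_irr_lin // mulr1 ger0_norm.
Qed.

(** Passing to the complement negates the nontrivial coefficients, whose sum
    is [1 - Q^-1], and replaces the trivial one, [Q^-1], by [1 - Q^-1].  It
    matters that this constant is proportional to the density [1 - Q^-1] of
    the complement: the densities then cancel from the final estimate. *)
Lemma multiplier_avoid :
  multiplier (2 * (1 - Q^-1)) (fun x => (x \notin H)%:R).
Proof.
pose b i := (if i == 0 then 1 - Q^-1 else - c i).
apply: (@multiplier_irr_sum b) => [x|].
  have ->: (x \notin H)%:R = 1 - (x \in H)%:R :> algC.
    by case: (x \in H); rewrite ?subrr ?subr0.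
  rewrite indicatorE (bigD1 0) //= [RHS](bigD1 0) //= {1}/b eqxx c0 irr0.
  rewrite cfun1E inE mulr1 mulr1 opprD addrA -sumrN; congr (_ + _).
  by apply: eq_bigr => i /negPf i0; rewrite /b i0 mulNr.
have Q1: 0 <= 1 - Q^-1.
  by rewrite subr_ge0 invf_le1 ?ler1n ?ltr0n.
rewrite (bigD1 0) //= {1}/b eqxx ger0_norm //.
have cS: 1 - Q^-1 = \sum_(i | i != 0) c i.
  have := c_sum; rewrite (bigD1 0) //= c0 => e; apply: (canLR (addrK _)).
  by rewrite addrC e.
rewrite mulr_natl mulr2n lerD2l cS.
by apply: ler_sum => i /negPf i0; rewrite /b i0 normrN ger0_norm.
Qed.

End SubgroupIndicator.

Lemma avoid_density_gt0 (H : {group gT}) x :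
  x \notin H -> 0 < 1 - (#|[set: gT] : H|%g%:R)^-1 :> algC.
Proof.
move=> xH; rewrite subr_gt0 invf_lt1 ?ltr0n ?ltr1n // indexg_gt1.
by apply: contra xH => /subsetP; apply; rewrite inE.
Qed.

(** Each [U i] supplements [H i], lies in all other [H j] and leaves [f0]
    invariant.  Hence [f0] multiplied by the conditions of avoiding the other
    [H j] is still invariant under [U i], and the condition of avoiding [H i]
    is independent of it. *)
Lemma product_sieve (J : eqType) (H U : J -> {group gT}) (js : seq J)
    (f0 : gT -> algC) (N0 : algC) (Q := fun j => #|[set: gT] : H j|%g%:R) :
    uniq js -> {in js, forall j, (U j * H j)%g = [set: gT]} ->
    {in js &, forall i j, i != j -> U i \subset H j} ->
    (forall j x u, j \in js -> u \in U j -> f0 (x * u)%g = f0 x) ->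
    multiplier N0 f0 ->
  let f x := f0 x * \prod_(j <- js) (x \notin H j)%:R in
  let theta := \prod_(j <- js) (1 - (Q j)^-1) in
  \sum_x f x = theta * \sum_x f0 x
  /\ multiplier (N0 * (2 ^+ size js * theta)) f.
Proof.
elim: js => [|j js IHjs] /=.
  move=> _ _ _ _ mf0; rewrite !big_nil !mulr1 mul1r.
  split; first by apply: eq_bigr => x _; rewrite big_nil mulr1.
  by move=> w B wB psi psiL; under eq_bigr do rewrite big_nil mulr1; apply: mf0.
case/andP=> jjs Ujs UH UsubH f0U mf0.
have sub: {subset js <= j :: js} by move=> i; rewrite inE orbC => ->.
have [Sf Mf] := IHjs Ujs (sub_in1 sub UH) (sub_in2 sub UsubH)
  (fun i x u ijs => f0U i x u (sub i ijs)) mf0.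
set f := fun x => f0 x * \prod_(j <- js) _ in Sf Mf.
set theta := \prod_(j <- js) _ in Sf Mf.
have fE x : f0 x * \prod_(i <- j :: js) (x \notin H i)%:R
            = f x * (x \notin H j)%:R.
  by rewrite big_cons mulrCA mulrC.
split.
  under eq_bigr => x _ do rewrite fE.
  have eN x: f x * (x \notin H j)%:R = f x - f x * (x \in H j)%:R.
    by case: (x \in H j); rewrite ?mulr1 ?mulr0 ?subrr ?subr0.
  under eq_bigr => x _ do rewrite eN.
  rewrite sumrB (@sum_supplement (U j) (H j)) ?UH ?mem_head //.
    by rewrite big_cons Sf -/theta -/(Q j); ring.
  move=> x u uU; rewrite /f (f0U j) ?mem_head //; congr (_ * _).
  apply: eq_big_seq => i ijs; rewrite groupMr //.
  have: U j \subset H i.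
    by apply: UsubH; rewrite ?inE ?eqxx ?ijs ?orbT //; apply: contraNneq jjs => ->.
  by move/subsetP; apply.
rewrite big_cons exprS -/theta.
have ->: N0 * (2 * 2 ^+ size js * ((1 - (Q j)^-1) * theta)) =
   (N0 * (2 ^+ size js * theta)) * (2 * (1 - (Q j)^-1)) by ring.
have mm := multiplierM Mf (@multiplier_avoid (H j)).
move=> w B wB psi psiL; under eq_bigr => x _ do rewrite fE.
exact: mm.
Qed.

End Multipliers.

(** * Gauss sums *)

(** Reindexing by the translation by [y] multiplies the sum by [psi y], which
    can be taken different from 1. *)
Lemma sum_lin_char (gT : finGroupType) (psi : 'CF([set: gT])) :
  psi \is a linear_char -> psi != 1 -> \sum_x psi x = 0.
Proof.
move=> psiL psi1.
have /existsP[y yN]: [exists y, psi y != 1].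
  apply: contraNT psi1; rewrite negb_exists => /forallP psi1.
  apply/eqP/cfunP => y; rewrite cfun1E inE.
  by have := psi1 y; rewrite negbK => /eqP.
have S: \sum_x psi x = psi y * \sum_x psi x.
  rewrite [LHS](reindex_inj (mulgI y)) mulr_sumr; apply: eq_bigr => x _.
  by rewrite lin_charM ?inE.
apply/eqP; have/eqP: (1 - psi y) * \sum_x psi x = 0.
  by rewrite mulrBl mul1r -S subrr.
by rewrite mulf_eq0 subr_eq0 eq_sym (negPf yN).
Qed.

Section GaussSum.

Variable K : finFieldType.
Implicit Types (psi : 'CF([set: K])) (chi : 'CF([set: {unit K}])).

Lemma sum_units (g : K -> algC) :
  \sum_(u : {unit K}) g (val u) = \sum_x g x - g 0.
Proof.
rewrite [in RHS](bigD1 0) //= addrAC subrr add0r.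
rewrite [RHS](reindex_onto (val : {unit K} -> K) (insubd (1%g : {unit K}))) /=.
  by apply: eq_bigl => u; rewrite valKd eqxx -unitfE (valP u).
by move=> x x0; rewrite insubdK // unitfE.
Qed.

Lemma sum_add_char_scale psi (c : K) :
    psi \is a linear_char -> psi != 1 ->
  \sum_x psi (x * c) = if c == 0 then #|K|%:R else 0.
Proof.
move=> psiL psi1; case: eqVneq => [->|c0].
  under eq_bigr => x _ do rewrite mulr0.
  have ->: psi 0 = 1 by exact: lin_char1 psiL.
  by rewrite sumr_const.
rewrite -[RHS](sum_lin_char psiL psi1) [RHS](reindex_inj (mulIf c0)).
by [].
Qed.

(** The square of the absolute value is a double sum over units [u], [v].  With
    [v = u * t], the inner sum over [u] is a sum of a nontrivial additive
    character at multiples of [1 - t]: it is [-1], unless [t] is 1. *)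
Lemma gauss_sum_bound psi chi :
    psi \is a linear_char -> chi \is a linear_char -> chi != 1 ->
  `|\sum_u chi u * psi (val u)| <= sqrtC #|K|%:R.
Proof.
move=> psiL chiL chi1.
have [->|psi1] := eqVneq psi 1.
  under eq_bigr => u _ do rewrite cfun1E inE mulr1.
  by rewrite sum_lin_char // normr0 sqrtC_ge0 ler0n.
rewrite -(@ler_pXn2r _ 2) ?nnegrE ?sqrtC_ge0 ?ler0n // sqrtCK normCK.
rewrite rmorph_sum mulr_suml.
have psi_conj x : (psi x)^* = psi (- x).
  by rewrite -lin_charV_conj ?inE.
have psiD x y : psi (x + y) = psi x * psi y by apply: lin_charM; rewrite ?inE.
have E (u : {unit K}) : (chi u * psi (val u)) * \sum_v (chi v * psi (val v))^* =
   \sum_(t : {unit K}) chi (t^-1)%g * (psi (val u * (1 - val t))).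
  rewrite mulr_sumr (reindex_inj (mulgI u)) /=; apply: eq_bigr => t _.
  rewrite rmorphM /= psi_conj lin_charM ?inE // rmorphM /= mulrACA -psiD.
  rewrite -lin_charV_conj ?inE // lin_charV ?inE //.
  rewrite mulrA divff ?lin_char_neq0 ?inE // mul1r -lin_charV_conj ?inE //.
  by rewrite mulrBr mulr1.
rewrite (eq_bigr _ (fun u _ => E u)) exchange_big /=.
have inner (t : {unit K}) :
    \sum_(u : {unit K}) chi (t^-1)%g * psi (val u * (1 - val t)) =
    chi (t^-1)%g * (if t == 1%g then #|K|%:R else 0) - chi (t^-1)%g.
  rewrite -mulr_sumr (sum_units (fun x => psi (x * (1 - val t)))).
  rewrite sum_add_char_scale // mul0r.
  have ->: psi 0 = 1 by exact: lin_char1 psiL.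
  by rewrite subr_eq0 [1 == _]eq_sym mulrBr mulr1.
rewrite (eq_bigr _ (fun t _ => inner t)) sumrB /=.
have ->: \sum_(t : {unit K}) chi (t^-1)%g = \sum_t chi t.
  by rewrite [RHS](reindex_inj invg_inj).
rewrite sum_lin_char // subr0 (bigD1 1%g) //= eqxx invg1 lin_char1 // mul1r.
rewrite big1 ?addr0 // => t /negPf ->; by rewrite mulr0.
Qed.

(** Subtracting from [f] its mean over the units leaves a weight on the group
    of units whose coefficient at the trivial character vanishes and whose
    other coefficients are twisted Gauss sums, bounded because [f] is an
    additive multiplier.  Then the multiplicative multiplier [s] can be
    applied to that weight; the subtracted mean accounts for the main term. *)
Lemma sum_mixed_weights (f : K -> algC) (s : {unit K} -> algC)
    (N1 N2 theta : algC) :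
    multiplier N1 f -> f 0 = 0 -> multiplier N2 s ->
    \sum_u s u = theta * #|{: {unit K}}|%:R ->
  `|\sum_u f (val u) * s u - theta * \sum_x f x| <= N2 * (N1 * sqrtC #|K|%:R).
Proof.
move=> mf f0 ms sumS.
set M := \sum_x f x.
have MU: \sum_(u : {unit K}) f (val u) = M by rewrite sum_units f0 subr0.
pose n : algC := #|{: {unit K}}|%:R.
have n0: n != 0.
  rewrite pnatr_eq0 -lt0n; apply/card_gt0P; by exists 1%g.
pose w (u : {unit K}) := f (val u) - M / n.
have bw: char_bounded (N1 * sqrtC #|K|%:R) w.
  have gauss chi : chi \is a linear_char -> chi != 1 ->
      `|\sum_u f (val u) * chi u| <= N1 * sqrtC #|K|%:R.
    move=> chiL chi1.
    (* chi extended by zero, as a weight on the additive group *)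
    pose wK (x : K) := if insub x is Some u then chi u else 0.
    have wKE (g : K -> algC) :
        \sum_x wK x * g x = \sum_(u : {unit K}) chi u * g (val u).
      have w0: wK 0 = 0 by rewrite /wK insubF // unitr0.
      have := sum_units (fun x => wK x * g x); rewrite /= w0 mul0r subr0 => <-.
      apply: eq_bigr => u _.
      by rewrite /wK valK.
    have bK: char_bounded (sqrtC #|K|%:R) wK.
      by move=> psi psiL; rewrite wKE gauss_sum_bound.
    have := mf _ _ bK 1 (rpred1 _).
    under eq_bigr => x _ do rewrite cfun1E inE mulr1.
    by rewrite wKE; under eq_bigr => x _ do rewrite mulrC.
  move=> chi chiL; have [->|chi1] := eqVneq chi 1.
    under eq_bigr => u _ do rewrite cfun1E inE mulr1.
    have SM: \sum_(u : {unit K}) M / n = M.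
      by rewrite sumr_const -[LHS]mulr_natr; apply: divfK n0 M.
    rewrite sumrB MU SM subrr normr0.
    by rewrite mulr_ge0 ?(multiplier_ge0 mf) ?sqrtC_ge0 ?ler0n.
  under eq_bigr => u _ do rewrite mulrBl.
  by rewrite sumrB -mulr_sumr sum_lin_char // mulr0 subr0 gauss.
have := ms _ _ bw 1 (rpred1 _).
under eq_bigr => u _ do rewrite cfun1E inE mulr1 mulrBl.
by rewrite sumrB -mulr_sumr sumS mulrCA (divfK n0).
Qed.

End GaussSum.

(** * Generators of cyclic groups and the numerical invariants *)

(** If [u] does not generate, any prime factor [p] of the index of [<[u]>] is
    a violated condition. *)
Lemma generator_expg_neq1 (gT : finGroupType) (u : gT) (n := #|[set: gT]|) :
    {in primes n, forall p, (u ^+ (n %/ p))%g != 1%g} ->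
  generator [set: gT] u.
Proof.
move=> uP; have n_gt0: (0 < n)%N by apply: cardG_gt0.
have un: (#[u]%g %| n)%N by rewrite order_dvdG ?inE.
rewrite /generator eq_sym eqEcard subsetT -/n /=.
have [e|n1] := eqVneq (n %/ #[u]%g)%N 1%N.
  by rewrite -(divnK un) e mul1n.
have n'_gt0: (0 < n %/ #[u]%g)%N by rewrite divn_gt0 ?order_gt0 // dvdn_leq.
have p_pr: prime (pdiv (n %/ #[u]%g)) by rewrite pdiv_prime // ltn_neqAle eq_sym n1.
set p := pdiv _ in p_pr.
have pn: (p * #[u]%g %| n)%N by rewrite -(divnK un) dvdn_pmul2r ?order_gt0 ?pdiv_dvd.
have pn1: (p %| n)%N by apply: dvdn_trans pn; apply: dvdn_mulr.
have := uP p; rewrite mem_primes p_pr n_gt0 pn1 => /(_ isT) /negP[].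
by rewrite -order_dvdn dvdn_divRL // mulnC.
Qed.

Section PowerSieve.
Variable gT : finGroupType.
Hypothesis abG : abelian [set: gT].
Let n := #|[set: gT]|.
(** [H p] collects the elements failing the generator criterion at [p]; the
    [p]-primary part [U p] supplements it, and lies in [H r] for every other
    prime [r]. *)
Let H p : {group gT} := Group (group_Ldiv (n %/ p) abG).
Let U p : {group gT} := Group (group_Ldiv (p ^ logn p n) abG).

Let n_gt0 : (0 < n)%N. Proof. exact: cardG_gt0. Qed.

Let inH p x : (x \in H p) = (x ^+ (n %/ p) == 1)%g.
Proof. by rewrite !inE. Qed.
Let inU p x : (x \in U p) = (x ^+ (p ^ logn p n) == 1)%g.
Proof. by rewrite !inE. Qed.

Let expgn (x : gT) j : (n %| j)%N -> (x ^+ j = 1)%g.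
Proof. by move=> /dvdnP[i ->]; rewrite mulnC expgM expg_cardG ?inE ?expg1n. Qed.

Let UH p : p \in primes n -> (U p * H p)%g = [set: gT].
Proof.
rewrite mem_primes => /and3P[p_pr _ pn].
apply/eqP; rewrite eqEsubset subsetT; apply/subsetP => x _.
pose a := (p ^ logn p n)%N; pose b := (n %/ a)%N.
have an: (a %| n)%N by apply: pfactor_dvdnn.
have a_gt0: (0 < a)%N by rewrite expn_gt0 prime_gt0.
have [b' cpb nE] := pfactor_coprime p_pr n_gt0.
have bE: b = b' by rewrite /b {1}nE mulnK.
have cab: coprime a b by rewrite bE coprimeXl.
have pa: (p %| a)%N by rewrite -{1}[p]expn1 dvdn_exp2l // logn_gt0 mem_primes p_pr n_gt0.
have abn: (a * b = n)%N by rewrite mulnC divnK.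
have [u v uv _] := egcdnP b a_gt0; rewrite (eqP cab) in uv.
have xE: (x ^+ (u * a) = x * x ^+ (v * b))%g by rewrite uv addn1 expgS.
have cxx: commute x (x ^+ (v * b))%g by apply: commuteX.
have -> : x = ((x ^+ (v * b))^-1 * x ^+ (u * a))%g by rewrite xE cxx mulKg.
rewrite mem_mulg //.
- by rewrite groupV inU -expgM -/a expgn // -mulnA (mulnC b) abn dvdn_mull.
rewrite inH -expgM expgn // -mulnA dvdn_mull //.
by rewrite -{1}(divnK pn) mulnC dvdn_mul.
Qed.

Let Usub p r : p \in primes n -> r \in primes n -> p != r -> U p \subset H r.
Proof.
rewrite !mem_primes => /and3P[p_pr _ pn] /and3P[r_pr _ rn] pr.
apply/subsetP => x; rewrite inU inH => /eqP xp.
have /dvdnP[j ->]: (p ^ logn p n %| n %/ r)%N.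
  rewrite dvdn_divRL // Gauss_dvd ?pfactor_dvdnn //.
  by rewrite coprimeXl // prime_coprime // dvdn_prime2.
by rewrite mulnC expgM xp expg1n.
Qed.

Lemma power_sieve :
    cyclic [set: gT] ->
  exists s : gT -> algC, exists2 theta : algC, 0 < theta &
    [/\ multiplier (2 ^+ size (primes n) * theta) s,
        \sum_x s x = theta * n%:R
      & forall x, s x != 0 -> generator [set: gT] x].
Proof.
case/cyclicP => g gG.
pose Q p : algC := #|[set: gT] : H p|%g%:R.
pose theta := \prod_(p <- primes n) (1 - (Q p)^-1).
have one_inv x u : (fun _ => 1 : algC) (x * u)%g = (fun _ : gT => 1) x by [].
have mone: multiplier 1 (fun _ : gT => 1).
  by move=> w B wB psi psiL; under eq_bigr do rewrite mulr1; rewrite mul1r wB.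
have [sumS mS] := @product_sieve gT abG _ H U (primes n) (fun _ => 1) 1
  (primes_uniq n) UH Usub (fun _ x u _ _ => one_inv x u) mone.
eexists; exists theta; last first.
  split; first by rewrite -[_ * theta]mul1r; apply: mS.
    by rewrite sumS sumr_const -cardsT.
  move=> x /=; rewrite mul1r prodf_seq_neq0 => /allP xP.
  apply: generator_expg_neq1 => p pn; have := xP p pn.
  by rewrite -/n -inH /= pnatr_eq0 eqb0 negbK.
rewrite /theta big_seq; apply: prodr_gt0 => p pn.
apply: (@avoid_density_gt0 _ (H p) g); rewrite inH -order_dvdn.
have -> : #[g]%g = n by rewrite /n gG.
have := pn; rewrite mem_primes => /and3P[p_pr _ pn'].
apply/negP => /dvdn_leq; rewrite divn_gt0 ?prime_gt0 // dvdn_leq // => /(_ isT).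
by rewrite leqNgt ltn_Pdiv ?prime_gt1.
Qed.
End PowerSieve.

Lemma logn_prod_primes (n : nat) (A : {set seq_sub (primes n)}) (p : nat) :
  prime p -> logn p (\prod_(i in A) val i)%N = [exists i in A, val i == p].
Proof.
move=> p_pr.
have vP (i : seq_sub (primes n)) : prime (val i).
  by have := valP i; rewrite mem_primes => /andP[].
have [_ ->]: (0 < \prod_(i in A) val i)%N
    /\ logn p (\prod_(i in A) val i)%N = (\sum_(i in A) logn p (val i))%N.
  apply: (big_rec2 (fun a b => (0 < a)%N /\ logn p a = b)); first by rewrite logn1.
  move=> i a b _ [a_gt0 <-]; split; first by rewrite muln_gt0 a_gt0 prime_gt0.
  by rewrite lognM // prime_gt0.
rewrite (eq_bigr (fun i : seq_sub (primes n) => (val i == p) : nat)); last first.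
  by move=> i _; rewrite logn_prime // eq_sym.
case: existsP => [[i /andP[iA /eqP ip]]|noi].
  rewrite (bigD1 i) //= ip eqxx big1 // => j /andP[_ ji].
  by rewrite -ip (inj_eq val_inj) (negPf ji).
rewrite big1 // => i iA; case: eqP => // ip; case: noi.
by exists i; rewrite iA ip eqxx.
Qed.

Lemma card_set_type (T : finType) : #|{: {set T}}| = (2 ^ #|T|)%N.
Proof. by rewrite -[LHS]cardsT -powersetT card_powerset cardsT. Qed.

(** The products of distinct prime factors of [n] are distinct square-free
    divisors. *)
Lemma exp2_primes_Wnat (n : nat) :
  (0 < n)%N -> (2 ^ size (primes n) <= Wnat n)%N.
Proof.
move=> n_gt0; rewrite -(card_seq_sub (primes_uniq n)) -card_set_type.
pose f (A : {set seq_sub (primes n)}) := (\prod_(i in A) val i)%N.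
have vP (i : seq_sub (primes n)) : prime (val i).
  by have := valP i; rewrite mem_primes => /andP[].
have f_gt0 A : (0 < f A)%N by rewrite prodn_gt0 // => i; rewrite prime_gt0.
have logf A i : logn (val i) (f A) = (i \in A).
  rewrite logn_prod_primes //; congr (nat_of_bool _); apply/existsP/idP.
    by case=> j /andP[jA /eqP /val_inj <-].
  by move=> iA; exists i; rewrite iA eqxx.
have f_inj: injective f.
  move=> A B eAB; apply/setP => i; move: (logf A i) (logf B i).
  by rewrite eAB => ->; do 2!case: (i \in _).
rewrite cardE -(size_map f) /Wnat -size_filter; apply: uniq_leq_size.
  by rewrite map_inj_uniq ?enum_uniq.
move=> _ /mapP[A _ ->]; rewrite mem_filter -dvdn_divisors //.
have fA p : prime p -> (logn p (f A) <= 1)%N.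
  by move=> p_pr; rewrite logn_prod_primes // leq_b1.
apply/andP; split.
  rewrite /squarefree f_gt0 /=; apply/allP => e; rewrite -dvdn_divisors // => ef.
  apply/implyP => e2; apply: contraT => e1.
  have e_gt0: (0 < e)%N by apply: dvdn_gt0 ef.
  have p_pr: prime (pdiv e) by rewrite pdiv_prime // ltn_neqAle eq_sym e1.
  have := fA _ p_pr; have := dvdn_leq_log (pdiv e) (f_gt0 A) e2.
  have : (0 < logn (pdiv e) e)%N by rewrite logn_gt0 pi_pdiv ltn_neqAle eq_sym e1.
  by rewrite lognX; lia.
apply/dvdn_partP => // p; rewrite mem_primes => /and3P[p_pr _ pf].
rewrite p_part pfactor_dvdn //; apply: leq_trans (fA p p_pr) _.
have: (0 < logn p (f A))%N by rewrite logn_gt0 mem_primes p_pr f_gt0 pf.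
rewrite logn_prod_primes // lt0b => /existsP[i /andP[_ /eqP ip]].
by rewrite -ip logn_gt0 (valP i).
Qed.

(** The indicator of [e] dividing a gcd is a product of indicators; this makes
    the inclusion-exclusion sum defining [lambda_deg] factor. *)
Lemma gcd_sum_totient (k m : nat) (d : 'I_k -> nat) (A : {set 'I_k}) :
    (0 < m)%N -> (forall i, (d i %| m)%N) -> A != set0 ->
  (\big[gcdn/0%N]_(i in A) d i)%:Z =
  \sum_(e < m.+1) (totient e)%:Z * \prod_(i in A) (e %| d i)%N%:R.
Proof.
move=> m_gt0 dm /set0Pn[i0 i0A]; set g := \big[_/_]_(_ in _) _.
have dvdg e : (e %| g)%N = [forall i in A, (e %| d i)%N].
  by apply/dvdn_biggcdP/forall_inP.
have gm: (g %| m)%N.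
  by apply: dvdn_trans (dm i0); have := dvdnn g; rewrite dvdg => /forall_inP; apply.
rewrite -{1}(sum_totient_dvd g).
have le_gm: (g.+1 <= m.+1)%N by rewrite ltnS dvdn_leq.
rewrite (big_ord_widen_cond m.+1 (fun e => e %| g)%N totient le_gm).
rewrite (big_morph Posz PoszD (erefl _)) big_mkcond; apply: eq_bigr => e _.
have ->: (e %| g)%N && (e < g.+1)%N = (e %| g)%N.
  rewrite andb_idr // ltnS => /dvdn_leq; apply.
  by apply: dvdn_gt0 gm.
rewrite dvdg; case: forall_inP => [eA|noA].
  by rewrite big1 ?mulr1 // => i iA; rewrite eA.
have [/exists_inP[i iA ei]|/exists_inPn h] := boolP [exists i in A, ~~ (e %| d i)%N].
  by rewrite (bigD1 i) //= (negPf ei) mul0r mulr0.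
by case: noA => i iA; have := h i iA; rewrite negbK.
Qed.

(** By inclusion-exclusion [lambda_deg d] is the sum of [totient e] over the
    [e] that divide at least one of the [d i]; the term [e = 1] gives 1. *)
Lemma lambda_deg_ge1 (k m : nat) (d : 'I_k -> nat) :
    (0 < k)%N -> (0 < m)%N -> (forall i, (d i %| m)%N) ->
  1 <= lambda_deg d.
Proof.
case: k d => // k d _ m_gt0 dm.
pose g (A : {set 'I_k.+1}) := (\big[gcdn/0%N]_(i in A) d i)%:Z.
have E1: lambda_deg d = \sum_(A : {set 'I_k.+1} | A != set0) (-1) ^+ #|A|.+1 * g A.
  pose S i := \sum_(A : {set 'I_k.+1} | #|A| == i) g A.
  have ->: lambda_deg d = \sum_(1 <= i < k.+2) (-1) ^+ i.+1 * S i.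
    rewrite big_ltn // expr2 mulrNN !mul1r; congr (_ + _).
    rewrite /S (big_morph Posz PoszD (erefl _)).
    rewrite (reindex_onto (fun i => [set i]) (fun A => odflt (ord0) [pick i in A])) /=.
      apply: eq_big => [i|i _].
        rewrite cards1 eqxx /=; case: pickP => [j|/(_ i)]; rewrite inE ?eqxx //.
      by rewrite /g big_set1.
    move=> A /cards1P[i ->]; case: pickP => [j|/(_ i)]; rewrite inE ?eqxx //.
    by move/eqP ->.
  rewrite big_add1 big_mkord /=.
  (* the sets of cardinal i.+1 are grouped under the index i : 'I_k.+1 *)
  rewrite [RHS](partition_big
    (fun A : {set 'I_k.+1} => inord #|A|.-1 : 'I_k.+1) xpredT) //=.
  apply: eq_bigr => i _; rewrite /S mulr_sumr; apply: eq_big => [A|A /eqP -> //].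
  rewrite -cards_eq0; case cA: #|A| => [|c] //=.
  have c_lt: (c < k.+1)%N by rewrite -cA -[X in (_ <= X)%N](card_ord k.+1) max_card.
  by rewrite -val_eqE /= inordK.
have {}E1: lambda_deg d =
    \sum_(e < m.+1) (totient e)%:Z * (1 - \prod_i (1 - (e %| d i)%N%:R)).
  rewrite E1.
  under eq_bigr => A A0 do rewrite /g (gcd_sum_totient m_gt0 dm A0) mulr_sumr.
  rewrite exchange_big /=; apply: eq_bigr => e _.
  under eq_bigr do rewrite mulrCA.
  rewrite -mulr_sumr; congr (_ * _).
  under [in RHS]eq_bigr do rewrite addrC.
  rewrite bigA_distr [in RHS](bigD1 set0) //= [X in 1 - (X + _)]big1; last first.
    by move=> i _; rewrite inE.
  rewrite opprD addrA subrr add0r -sumrN; apply: eq_bigr => A _.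
  by rewrite -big_mkcond prodrN exprS mulN1r mulNr.
rewrite E1 (bigD1 (Ordinal (m_gt0 : 1 < m.+1)%N)) //= totientE // big_nil mul1r.
rewrite big_ord_recl dvd1n subrr mul0r subr0 lerDl.
apply: sumr_ge0 => e _; rewrite mulr_ge0 // subr_ge0.
by apply: prodr_ile1 => i _; case: (_ %| _)%N.
Qed.

(** The squared form of the hypothesis avoids half-integral exponents; the
    extra factor [q ^ 2] comes from [1 <= l]. *)
Lemma real_bound_nat (R : realType) (q m D w : nat) (l : int) :
    (1 < q)%N -> 1 <= l ->
    w%:R <= q%:R `^ (m%:R / 2%:R - l%:~R - D%:R) :> R ->
  (w ^ 2 * q ^ (2 * D + 2) <= q ^ m)%N.
Proof.
move=> q1 l1 b.
have q0: 0 < q%:R :> R by rewrite ltr0n ltnW.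
have bl: w%:R <= q%:R `^ (m%:R / 2%:R - 1 - D%:R) :> R.
  apply: (le_trans b); rewrite ler_powR ?ler1n ?(ltnW q1) //.
  by rewrite lerD2r lerD2l lerN2 -[1]/(1%:~R) ler_int.
rewrite -(ler_nat R) natrM !natrX.
have ->: q%:R ^+ m = (q%:R `^ (m%:R / 2%:R - 1 - D%:R)) ^+ 2 * q%:R ^+ (2 * D + 2) :> R.
  rewrite -!powR_mulrn ?powR_ge0 ?ler0n // -powRrM -powRD; last first.
    by rewrite (gt_eqF q0) implybT.
  by congr (_ `^ _); rewrite natrD natrM; field.
by rewrite ler_wpM2r ?exprn_ge0 ?ler0n // lerXn2r ?nnegrE ?powR_ge0 ?ler0n.
Qed.

(** * The Frobenius module structure and prescribed traces *)

Section FrobeniusModule.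

Import FalgLfun.

Variables (F : finFieldType) (L : fieldExtType F).
Local Notation q := #|F|.
Local Notation m := (\dim {:L}).
Implicit Types (x y : L) (g h : {poly F}) (n d : nat).

Definition frobenius x : L := x ^+ q.

Lemma frobenius_linear : linear frobenius.
Proof.
move=> c x y; rewrite /frobenius; have [p p_pr pF] := finPcharP F.
have qE: [pchar L].-nat q.
  have pL: p \in [pchar L] by rewrite pchar_lalg.
  rewrite (eq_pnat _ (pcharf_eq pL)) -cardsT.
  exact: (pprimeChar_pgroup pF).
by rewrite exprDn_pchar // exprZn expf_card.
Qed.
HB.instance Definition _ :=
  GRing.isLinear.Build F L L _ frobenius frobenius_linear.

(** The polynomial [g] evaluated at the Frobenius map; normality and traces
    over [F] are statements about this module. *)
Definition frob_act g : 'End(L) := horner_alg (linfun frobenius : 'End(L)) g.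

Lemma frob_actM g h x : frob_act (g * h) x = frob_act g (frob_act h x).
Proof. by rewrite mulrC /frob_act rmorphM lfun_mulE. Qed.

Lemma frob_act1 x : frob_act 1 x = x.
Proof. rewrite /frob_act rmorph1. exact: id_lfunE. Qed.

Lemma frob_actB g h x : frob_act (g - h) x = frob_act g x - frob_act h x.
Proof. by rewrite /frob_act rmorphB add_lfunE opp_lfunE. Qed.

Lemma frob_actD g h x : frob_act (g + h) x = frob_act g x + frob_act h x.
Proof. by rewrite /frob_act rmorphD add_lfunE. Qed.

Lemma frob_actZ c g x : frob_act (c *: g) x = c *: frob_act g x.
Proof.
rewrite -mul_polyC mulrC /frob_act rmorphM lfun_mulE /= horner_algC.
by rewrite scale_lfunE; congr (_ *: _); apply: id_lfunE.
Qed.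

Lemma frob_act_sum (I : Type) (r : seq I) (P : pred I) (G : I -> {poly F}) x :
  frob_act (\sum_(i <- r | P i) G i) x = \sum_(i <- r | P i) frob_act (G i) x.
Proof. by rewrite /frob_act rmorph_sum sum_lfunE. Qed.

Lemma frob_actXn n x : frob_act 'X^n x = x ^+ (q ^ n).
Proof.
elim: n x => [|n IHn] x; first by rewrite expr0 frob_act1 expn0 expr1.
by rewrite exprSr frob_actM IHn {1}/frob_act horner_algX lfunE /= -exprM expnS.
Qed.

Lemma frob_act_comm g h x : frob_act g (frob_act h x) = frob_act h (frob_act g x).
Proof. by rewrite -!frob_actM mulrC. Qed.

Lemma frob_actE g x n : (size g <= n)%N ->
  frob_act g x = \sum_(i < n) g`_i *: x ^+ (q ^ i).
Proof.
move=> gn; rewrite -[g in LHS](coefK g) poly_def frob_act_sum.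
rewrite (big_ord_widen _ (fun i => frob_act (g`_i *: 'X^i) x) gn) big_mkcond.
apply: eq_bigr => i _; rewrite frob_actZ frob_actXn; case: ltnP => // gi.
by rewrite nth_default // scale0r.
Qed.

Lemma mem_subfield_frob_act (K : {subfield L}) x :
  (x \in K) = (frob_act 'X^(\dim K) x == x).
Proof. by rewrite Fermat's_little_theorem frob_actXn. Qed.

Lemma frob_act_Xm x : frob_act 'X^m x = x.
Proof. by apply/eqP; rewrite -mem_subfield_frob_act memvf. Qed.

Lemma frob_act_Xm_sub1 x : frob_act ('X^m - 1) x = 0.
Proof. by rewrite frob_actB frob_act1 frob_act_Xm subrr. Qed.

Lemma frob_act_dvdp g h x : g %| h -> frob_act g x = 0 -> frob_act h x = 0.
Proof. by case/dvdpP => r -> gx; rewrite frob_actM gx linear0. Qed.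

Lemma card_finvect : #|{: finvect_type L}| = (q ^ m)%N.
Proof. by rewrite -(card_vspace {: finvect_type L}) card_vspacef. Qed.

(** The value of [frob_act g] at [x] is the value at [x] of a nonzero
    polynomial of degree at most [q ^ (m - 1)], too small to vanish on the whole
    field. *)
Lemma frob_act_faithful g : g != 0 -> (size g <= m)%N -> exists x, frob_act g x != 0.
Proof.
move=> g0 gm; have q_gt1: (1 < q)%N := finNzRing_gt1 F.
suff /existsP[x xP]: [exists x : finvect_type L, frob_act g x != 0] by exists x.
apply: contraT; rewrite negb_exists => /forallP all0.
pose P : {poly L} := \sum_(i < m) (g`_i)%:A *: 'X^(q ^ i).
have PE x : P.[x] = frob_act g x.
  rewrite (frob_actE _ gm) horner_sum; apply: eq_bigr => i _.
  by rewrite !hornerE mulr_algl.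
have m_gt0: (0 < m)%N by rewrite (leq_trans _ gm) // lt0n size_poly_eq0.
have P0: P != 0.
  have jm: ((size g).-1 < m)%N by rewrite prednK ?lt0n ?size_poly_eq0.
  apply/eqP => /(congr1 (coefp (q ^ (size g).-1))) /eqP.
  rewrite /coefp /= coef0 coef_sum (bigD1 (Ordinal jm)) //= big1 => [|i ij].
    rewrite addr0 coefZ coefXn eqxx mulr1 scaler_eq0 oner_eq0 orbF.
    by rewrite -/(lead_coef g) lead_coef_eq0 (negPf g0).
  rewrite coefZ coefXn eqn_exp2l //; case: eqP => [e|_]; last by rewrite mulr0.
  by case/eqP: ij; apply: val_inj.
have sP: (size P <= (q ^ m.-1).+1)%N.
  apply: (leq_trans (size_sum _ _ _)); apply/bigmax_leqP => i _.
  apply: (leq_trans (size_scale_leq _ _)); rewrite size_polyXn ltnS.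
  by rewrite leq_exp2l // -ltnS prednK.
have roots: all (root P) (enum (finvect_type L)).
  by apply/allP => x _; rewrite /root PE; have := all0 x; rewrite negbK.
have /leq_trans/(_ sP): (q ^ m < size P)%N.
  by rewrite -card_finvect cardE; apply: max_poly_roots P0 roots (enum_uniq _).
rewrite ltnS -{1}(prednK m_gt0) leq_exp2l //.
by rewrite ltnn.
Qed.

Lemma frob_act_coprimep g h x : coprimep g h -> exists u v,
  x = frob_act u (frob_act g x) + frob_act v (frob_act h x).
Proof.
case/Bezout_eq1_coprimepP => -[u v] /= uv; exists u, v.
by rewrite -!frob_actM -frob_actD uv frob_act1.
Qed.

(** Equal to [(X^n - 1) / (X^d - 1)] when [d] divides [n]. *)
Definition trace_poly n d : {poly F} := \sum_(i < n %/ d) 'X^(i * d).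

Lemma frob_act_trace_poly n d x : frob_act (trace_poly n d) x = trace q n d x.
Proof. by rewrite frob_act_sum; apply: eq_bigr => i _; rewrite frob_actXn. Qed.

Lemma trace_polyM n d : (d %| n)%N -> trace_poly n d * ('X^d - 1) = 'X^n - 1.
Proof.
case/dvdnP => j ->; rewrite /trace_poly.
have [->|d_gt0] := posnP d; first by rewrite muln0 div0n big_ord0 mul0r expr0 subrr.
have XM i : 'X^(i * d) = 'X^d ^+ i :> {poly F} by rewrite mulnC exprM.
rewrite mulnK // XM [RHS]subrX1 mulrC; congr (_ * _).
by apply: eq_bigr => i _.
Qed.

Lemma Xn_sub1_neq0 d : (0 < d)%N -> 'X^d - 1 != 0 :> {poly F}.
Proof. by move=> d_gt0; rewrite monic_neq0 // monicXnsubC. Qed.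

Lemma trace_poly_trans n d e : (0 < e)%N -> (e %| d)%N -> (d %| n)%N ->
  trace_poly n e = trace_poly d e * trace_poly n d.
Proof.
move=> e_gt0 ed dn; apply: (mulIf (Xn_sub1_neq0 e_gt0)).
rewrite trace_polyM ?(dvdn_trans ed) // mulrAC trace_polyM //.
by rewrite mulrC trace_polyM.
Qed.

Lemma fixed_iter d j x : frob_act 'X^d x = x -> frob_act 'X^(j * d) x = x.
Proof.
move=> fx; elim: j => [|j IHj]; first by rewrite mul0n frob_act1.
by rewrite mulSn exprD frob_actM IHj.
Qed.

(** Bezout on the exponents. *)
Lemma fixed_gcd c d x : (0 < c)%N ->
  frob_act 'X^c x = x -> frob_act 'X^d x = x -> frob_act 'X^(gcdn c d) x = x.
Proof.
move=> c_gt0 cx dx; have [u v uv _] := egcdnP d c_gt0.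
by rewrite -{1}(fixed_iter v dx) -frob_actM -exprD addnC -uv fixed_iter.
Qed.

Lemma frob_act_trace_fixed n d x : frob_act 'X^d x = x ->
  frob_act (trace_poly n d) x = (n %/ d)%:R *: x.
Proof.
move=> dx; rewrite frob_act_sum (eq_bigr (fun=> x)) => [|i _].
  by rewrite sumr_const card_ord scaler_nat.
exact: fixed_iter.
Qed.

Section Averages.

Hypothesis m_unit : m%:R != 0 :> F.

Let div_unit d : (d %| m)%N -> d%:R != 0 :> F.
Proof.
move/dvdnP => [j e]; move: m_unit.
by rewrite e natrM mulf_eq0 negb_or => /andP[].
Qed.
Let quo_unit d : (d %| m)%N -> (m %/ d)%:R != 0 :> F.
Proof. by move=> dm; apply/div_unit/dvdn_div. Qed.

(** The mean over the Galois group of [L] over its subfield of degree [d], that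
    is, the projection onto that subfield. *)
Definition average d : 'End(L) := frob_act ((m %/ d)%:R^-1 *: trace_poly m d).

Lemma averageE d x : average d x = (m %/ d)%:R^-1 *: frob_act (trace_poly m d) x.
Proof. exact: frob_actZ. Qed.

Lemma average_comm c d x : average c (average d x) = average d (average c x).
Proof. exact: frob_act_comm. Qed.

Lemma average_fixed d x : (d %| m)%N -> frob_act 'X^d x = x -> average d x = x.
Proof.
move=> dm dx; rewrite averageE frob_act_trace_fixed // scalerA mulVf ?scale1r //.
exact: quo_unit.
Qed.

Lemma fixed_average d x : (d %| m)%N -> frob_act 'X^d (average d x) = average d x.
Proof.
move=> dm; apply/eqP; rewrite -subr_eq0 -{2}[average d x]frob_act1 -frob_actB averageE.
by rewrite linearZ /= -frob_actM mulrC trace_polyM // frob_act_Xm_sub1 scaler0.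
Qed.

Lemma average_frob d x : (d %| m)%N -> average d (frob_act 'X^d x) = average d x.
Proof. by move=> dm; rewrite /average frob_act_comm fixed_average. Qed.

(** Let [g] be the gcd.  The average of [x] over the powers of Frobenius^[c]
    is fixed by the [c]-th and the [d]-th power of Frobenius, hence by the
    [g]-th, so that applying [average g] does not change it.  But [average g]
    absorbs [average c]. *)
Lemma average_gcd c d x : (0 < c)%N -> (c %| m)%N -> (d %| m)%N ->
  frob_act 'X^d x = x -> average c x = average (gcdn c d) x.
Proof.
move=> c_gt0 cm dm dx; set g := gcdn c d.
have gm: (g %| m)%N by apply: dvdn_trans cm; apply: dvdn_gcdl.
have fg: frob_act 'X^g (average c x) = average c x.
  by apply: fixed_gcd => //; rewrite ?fixed_average // /average frob_act_comm dx.
rewrite -(average_fixed gm fg).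
have gX y i : average g (frob_act 'X^(i * g) y) = average g y.
  elim: i => [|i IHi]; first by rewrite mul0n frob_act1.
  by rewrite mulSn exprD frob_actM average_frob.
have gcX y i : average g (frob_act 'X^(i * c) y) = average g y.
  by have /dvdnP[r ->] : (g %| c)%N by [apply: dvdn_gcdl]; rewrite mulnA gX.
rewrite [average c x]averageE linearZ frob_act_sum linear_sum /=.
rewrite (eq_bigr (fun=> average g x)) => [|i _].
  by rewrite sumr_const card_ord -scaler_nat scalerA mulVf ?scale1r ?quo_unit.
exact: gcX.
Qed.

Variables (k : nat) (d : 'I_k -> nat) (a : 'I_k -> L).
Hypotheses (d_gt0 : forall i, (0 < d i)%N) (dm : forall i, (d i %| m)%N).
Hypothesis a_fixed : forall i, frob_act 'X^(d i) (a i) = a i.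
Hypothesis a_adm : admissible q d a.

(** The conditions on the traces read [average (d i) x = b i]. *)
Let b i := (m %/ d i)%:R^-1 *: a i.

Let b_fixed i : frob_act 'X^(d i) (b i) = b i.
Proof. by rewrite linearZ /= a_fixed. Qed.

(** By [average_gcd] the left-hand side is a multiple of the trace of [a j]
    down to degree [gcd (d i) (d j)]; written this way, with a factor
    symmetric in [i] and [j], admissibility becomes
    [average (d i) (b j) = average (d j) (b i)]. *)
Let average_bE i j : average (d i) (b j) = (gcdn (d i) (d j))%:R / m%:R *:
  trace q (d j) (gcdn (d i) (d j)) (a j).
Proof.
set g := gcdn _ _; have g_gt0: (0 < g)%N by rewrite gcdn_gt0 d_gt0.
have gj: (g %| d j)%N by apply: dvdn_gcdr.
have gm := dvdn_trans gj (dm j).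
rewrite (average_gcd _ _ (dm j)) // -/g averageE.
rewrite (trace_poly_trans g_gt0 gj (dm j)) frob_actM (frob_act_trace_fixed _ (b_fixed j)).
rewrite [X in frob_act _ X]scalerA mulfV ?quo_unit // scale1r frob_act_trace_poly.
congr (_ *: _).
have e: m%:R = (m %/ g)%:R * g%:R :> F by rewrite -natrM divnK.
by rewrite e invfM mulrCA divff ?mulr1 ?div_unit.
Qed.

Let average_b_sym i j : average (d i) (b j) = average (d j) (b i).
Proof.
rewrite !average_bE gcdnC; congr (_ *: _).
case: (ltngtP i j) => [ij|ji|/val_inj -> //]; last exact: a_adm.
by rewrite gcdnC; symmetry; apply: a_adm.
Qed.

(** Conditions are imposed one by one: adding the error [b i - average (d i) x]
    corrects condition [i], and for a condition [j] already met the average of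
    this error is zero because the projections commute. *)
Lemma prescribed_traces_exist :
  exists x : L, forall i, trace q m (d i) x = a i.
Proof.
suff [x xb]: exists x, {in enum 'I_k, forall i, average (d i) x = b i}.
  exists x => i; have := xb i (mem_enum _ i); rewrite averageE /b.
  by rewrite frob_act_trace_poly => /(scalerI (invr_neq0 (quo_unit (dm i)))).
elim: (enum _) => [|i s [x xs]]; first by exists 0.
exists (x + (b i - average (d i) x)) => j; rewrite inE.
have bb l : average (d l) (b l) = b l by apply: average_fixed.
have idem y : average (d i) (average (d i) y) = average (d i) y.
  by rewrite average_fixed ?fixed_average.
rewrite linearD linearB /=; case/predU1P => [->|js].
  by rewrite idem bb addrC subrK.
rewrite average_comm xs // average_b_sym subrr addr0 //.
Qed.

End Averages.

(** Each trace takes its values in a space of dimension [d i], so each step of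
    the intersection loses at most that much dimension. *)
Lemma trace_kernel_dim (k : nat) (d : 'I_k -> nat) (K : 'I_k -> {subfield L})
    (s : seq 'I_k) :
    (forall i, (d i %| m)%N) -> (forall i, \dim (K i) = d i) ->
  (m <= \dim (\bigcap_(i <- s) lker (frob_act (trace_poly m (d i)))) +
        \sum_(i <- s) d i)%N.
Proof.
move=> dm dK; elim: s => [|i s IHs].
  by rewrite !big_nil addn0.
rewrite !big_cons; apply: leq_trans IHs _; rewrite addnA leq_add2r capvC.
rewrite -(limg_ker_dim (frob_act (trace_poly m (d i))) (\bigcap_(j <- s) _)) leq_add2l.
rewrite -dK; apply: dimvS; apply/subvP => _ /memv_imgP[y _ ->].
rewrite mem_subfield_frob_act dK -subr_eq0 -{2}[frob_act _ y]frob_act1.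
rewrite -frob_actB -frob_actM mulrC.
by rewrite trace_polyM // frob_act_Xm_sub1.
Qed.

End FrobeniusModule.

(** * Irreducible factors and normal elements *)

Section MonicIrreducibles.

Variable F : finFieldType.
Implicit Types f g h p r : {poly F}.

Lemma monic_irreducible_dvdp_eq p r : p \is monic -> irreducible_poly p ->
  r \is monic -> irreducible_poly r -> p %| r -> p = r.
Proof.
move=> pM [p_gt1 pI] rM rI pr; apply/eqP; rewrite -eqp_monic //.
by apply: (apply_irredp rI) => //; rewrite gtn_eqF.
Qed.

Lemma monic_irreducible_factor g :
  (1 < size g)%N -> exists p, [/\ p \is monic, irreducible_poly p & p %| g].
Proof.
have [n] := ubnP (size g); elim: n g => // n IHn g; rewrite ltnS => gn g_gt1.
have g0: g != 0 by rewrite -size_poly_gt0 ltnW.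
have [/irreducibleP gI|] := boolP (irreducibleb g).
  have c0: (lead_coef g)^-1 != 0 by rewrite invr_eq0 lead_coef_eq0.
  exists ((lead_coef g)^-1 *: g); split.
  - by rewrite monicE lead_coefZ mulVf ?lead_coef_eq0.
  - split; first by rewrite size_scale.
    move=> r r1 rg; rewrite (eqp_trans (gI.2 r r1 _)) //.
      by rewrite -(eqp_dvdr _ (eqp_scale _ c0)).
    by rewrite eqp_sym eqp_scale.
  by rewrite (eqp_dvdl _ (eqp_scale _ c0)).
rewrite /irreducibleb g_gt1 /= negb_forall => /existsP[r].
rewrite negb_imply -Pdiv.Idomain.dvdpE -ltnNge => /andP[rg r_gt1].
have rs: (size (r : {poly F}) < n)%N.
  apply: leq_trans gn; rewrite -[in X in (_ < X)%N](prednK (ltnW g_gt1)) ltnS.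
  exact: size_npoly.
have [p [pM pI pr]] := IHn _ rs r_gt1.
by exists p; split=> //; apply: dvdp_trans rg.
Qed.

Variable f : {poly F}.
Hypothesis f_sep : separable_poly f.

Definition monic_irreducible_factors : seq {poly F} :=
  [seq (g : {poly F}) | g : {poly_(size f) F} <- enum {poly_(size f) F} &
     [&& (g : {poly F}) \is monic, irreducibleb g & (g : {poly F}) %| f]].
Local Notation ps := monic_irreducible_factors.

Lemma mem_monic_irreducible_factors p :
  reflect [/\ p \is monic, irreducible_poly p & p %| f] (p \in ps).
Proof.
have f0: f != 0 by apply: separable_poly_neq0.
apply: (iffP mapP) => [[g]|[pM pI pf]].
  by rewrite mem_filter => /andP[/and3P[gM /irreducibleP gI gf] _] ->.
have ps: (size p <= size f)%N by apply: dvdp_leq.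
exists (NPoly ps) => //; rewrite mem_filter mem_enum andbT /= pM pf andbT /=.
exact/irreducibleP.
Qed.

Lemma monic_irreducible_factors_uniq : uniq ps.
Proof.
rewrite map_inj_uniq ?filter_uniq -?enumT ?enum_uniq // => g h gh.
exact: (@val_inj _ _ {poly_(size f) F}).
Qed.

Lemma separable_coprime_cofactor p : p %| f -> coprimep p (f %/ p).
Proof.
by move=> pf; apply: (separable_coprime f_sep); rewrite mulrC divpK.
Qed.

Local Notation J := (seq_sub ps).

Let JP (i : J) : [/\ val i \is monic, irreducible_poly (val i) & val i %| f].
Proof. exact/mem_monic_irreducible_factors/(valP i). Qed.

Let dvdp_prod_factors (i : J) (s : seq J) :
  (val i %| \prod_(j <- s) val j) = (i \in s).
Proof.
elim: s => [|j s IHs].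
  by rewrite big_nil dvdp1 gtn_eqF //; case: (JP i) => _ [].
rewrite big_cons inE; have [-> | ij] := eqVneq i j; first by rewrite dvdp_mulr.
rewrite Gauss_dvdpr // irreducible_poly_coprime; last by case: (JP i).
apply: contra ij => ij; apply/eqP/val_inj.
by case: (JP i) (JP j) => iM iI _ [jM jI _]; apply: monic_irreducible_dvdp_eq.
Qed.

(** The products of distinct monic irreducible factors are distinct monic
    divisors of [f], and a divisor of a separable polynomial is square-free. *)
Lemma exp2_factors_Wpoly : (2 ^ size ps <= Wpoly f)%N.
Proof.
have f0: f != 0 by apply: separable_poly_neq0.
rewrite -(card_seq_sub monic_irreducible_factors_uniq) -card_set_type.
pose pr (A : {set J}) : {poly F} := \prod_(i <- enum A) val i.
have prM A : pr A \is monic by apply: monic_prod => i _; case: (JP i).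
have prf A : pr A %| f.
  rewrite /pr; move: (enum_uniq A); elim: (enum A) => [|i s IHs] /=.
    by rewrite big_nil dvd1p.
  case/andP=> iS sU; rewrite big_cons Gauss_dvdp ?IHs //; first by case: (JP i) => _ _ ->.
  by rewrite irreducible_poly_coprime ?dvdp_prod_factors //; case: (JP i).
have prs A : (size (pr A) <= size f)%N by apply: dvdp_leq.
pose G A : {poly_(size f) F} := NPoly (prs A).
have G_inj: injective G.
  move=> A B /(congr1 val) /= AB; apply/setP => i.
  by rewrite -mem_enum -dvdp_prod_factors -/(pr A) AB dvdp_prod_factors mem_enum.
rewrite -(card_codom G_inj); apply: subset_leq_card; apply/subsetP => _ /codomP[A ->].
rewrite !inE /= prM prf andbT /=; apply/forallP => h; apply/implyP => h2.
have hh: coprimep (h : {poly F}) (h : {poly F}).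
  by apply: (separable_coprime f_sep); rewrite -expr2 (dvdp_trans h2).
by move: hh; rewrite /coprimep gcdpp.
Qed.

Lemma size_Xn_sub1_cofactor (n : nat) p : (0 < n)%N -> irreducible_poly p ->
  (size (('X^n - 1 : {poly F}) %/ p)%R <= n)%N.
Proof.
move=> n_gt0 [p_gt1 _].
have p0: p != 0 by rewrite -size_poly_gt0 ltnW.
rewrite size_divp // size_XnsubC //; case: (size p) p_gt1 => [|[|j]] // _.
by rewrite /= subSS leq_subr.
Qed.

End MonicIrreducibles.

Section Normality.

Variables (F : finFieldType) (L : fieldExtType F).
Local Notation q := #|F|.
Local Notation m := (\dim {:L}).
Implicit Types (x y : L) (g h : {poly F}).

(** A linear relation between the conjugates of [x] is the same thing as a
    polynomial annihilating [x]. *)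
Lemma conjugates_freeP n x :
  reflect (forall g, g != 0 -> (size g <= n)%N -> frob_act L g x != 0)
    (free [seq x ^+ (q ^ j) | j <- iota 0 n]).
Proof.
have XE: [seq x ^+ (q ^ j) | j <- iota 0 n] = [tuple x ^+ (q ^ i) | i < n].
  by rewrite /= -val_enum_ord -map_comp.
have XiE (i : 'I_n) : [tuple x ^+ (q ^ i) | i < n]`_i = x ^+ (q ^ i).
  by rewrite -tnth_nth tnth_mktuple.
rewrite XE; apply: (iffP freeP) => [fr g g0 gn|H k k0 i].
  apply: contraNneq g0 => gx; apply/eqP/polyP => i; rewrite coef0.
  have [ni|ilt] := leqP n i; first by rewrite nth_default // (leq_trans gn).
  apply: (fr (fun i => g`_i) _ (Ordinal ilt)).
  by rewrite -[RHS]gx (frob_actE _ gn); apply: eq_bigr => j _; rewrite XiE.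
pose g := \poly_(i < n) (if insub i is Some i' then k i' else 0).
have gE (j : 'I_n) : g`_j = k j by rewrite coef_poly ltn_ord valK.
have gn: (size g <= n)%N by apply: size_poly.
rewrite -gE; suff -> : g = 0 by rewrite coef0.
apply: contraTeq isT => g0; have := H g g0 gn; rewrite (frob_actE _ gn).
case/negP; apply/eqP; rewrite -[RHS]k0; apply: eq_bigr => j _.
by rewrite gE XiE.
Qed.

Lemma normal_elt_frob_act (K : {subfield L}) x g :
  normal_elt K x -> g != 0 -> (size g <= \dim K)%N -> frob_act L g x != 0.
Proof. by move/basis_free/conjugates_freeP; apply. Qed.

Lemma frob_act_normal_elt x :
  (forall g, g != 0 -> (size g <= m)%N -> frob_act L g x != 0) ->
  normal_elt {:L}%AS x.
Proof.
move=> H; rewrite /normal_elt basisEfree subvf size_map size_iota leqnn !andbT.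
exact/conjugates_freeP.
Qed.

(** If [g] annihilates [x], so does its gcd with [X^m - 1], a proper divisor
    of [X^m - 1], hence a divisor of some maximal one. *)
Lemma normal_elt_cofactors x :
    (forall p, p \is monic -> irreducible_poly p -> p %| 'X^m - 1 ->
       frob_act L (('X^m - 1) %/ p) x != 0) ->
  normal_elt {:L}%AS x.
Proof.
move=> H; apply: frob_act_normal_elt => g g0 gm; apply/negP => /eqP gx.
have m_gt0 : (0 < m)%N by rewrite (leq_trans _ gm) // size_poly_gt0.
set f : {poly F} := 'X^m - 1 in H *.
have f0: f != 0 by apply: Xn_sub1_neq0.
have [[u v] /= uv] := Bezoutp g f.
set g1 := gcdp g f in uv.
have g1x: frob_act L g1 x = 0.
  apply: (frob_act_dvdp (g := u * g + v * f)); first by rewrite (eqp_dvdl _ uv).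
  by rewrite frob_actD !frob_actM gx frob_act_Xm_sub1 !linear0 addr0.
have g1f: g1 %| f by apply: dvdp_gcdr.
have g1_0 : g1 != 0 by rewrite gcdp_eq0 (negPf g0).
have sf: size f = m.+1 by rewrite size_XnsubC.
have s1: (size g1 <= m)%N by apply: leq_trans gm; rewrite dvdp_leq ?dvdp_gcdl.
have fq: (1 < size (f %/ g1)%R)%N.
  rewrite size_divp // sf; move: s1; have := g1_0; rewrite -size_poly_gt0; lia.
have [p [pM pI pd]] := monic_irreducible_factor fq.
have pf: p %| f by rewrite (dvdp_trans pd) // divp_dvd.
have := H p pM pI pf; case/negP; apply/eqP; apply: (frob_act_dvdp (g := g1)) => //.
have p0: p != 0 by apply: monic_neq0.
rewrite -(dvdp_mul2r _ _ p0) divpK // -(divpK g1f) mulrC.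
by rewrite dvdp_mul2r.
Qed.

(** Both [n] and [q] would vanish in [F], hence so would their gcd. *)
Lemma coprime_natf_neq0 n : coprime n q -> n%:R != 0 :> F.
Proof.
have [-> | n_gt0 nq] := posnP n.
  by rewrite /coprime gcd0n => /eqP q1; have := finNzRing_gt1 F; rewrite q1.
have q0: q%:R = 0 :> F by rewrite -cardsT -FinRing.zmodXgE expg_cardG ?inE.
have [u v uv _] := egcdnP q n_gt0; rewrite (eqP nq) in uv.
apply/negP => /eqP n0; have := congr1 (fun i => i%:R : F) uv.
by rewrite natrD !natrM n0 q0 !mulr0 add0r => /esym/eqP; rewrite oner_eq0.
Qed.

End Normality.

(** * Normal elements with prescribed traces, and the existence theorem *)

Section AdditiveSieve.

Variables (F : finFieldType) (L : fieldExtType F).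
Local Notation q := #|F|.
Local Notation m := (\dim {:L}).
Local Notation K := (finvect_type L : finFieldType).
Local Notation f := ('X^m - 1 : {poly F}).

Fact vspace_group_set (V : {vspace L}) : group_set [set x : K | x \in V].
Proof.
apply/group_setP; split; first by rewrite inE; apply: mem0v.
by move=> x y; rewrite !inE; apply: memvD.
Qed.
Definition vspace_group V : {group K} := Group (vspace_group_set V).

Lemma mem_vspace_group V (x : K) : (x \in vspace_group V) = (x \in V).
Proof. by rewrite inE. Qed.

Variables (k : nat) (d : 'I_k -> nat) (a : 'I_k -> L).
Variable E : 'I_k -> {subfield L}.
Hypotheses (m_unit : m%:R != 0 :> F).
Hypotheses (d_gt0 : forall i, (0 < d i)%N) (dm : forall i, (d i %| m)%N).
Hypothesis dimE : forall i, \dim (E i) = d i.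
Hypothesis aE : forall i, a i \in E i.
Hypothesis a_adm : admissible q d a.
Hypothesis a_normal : forall i, normal_elt (E i) (a i).

(** The weight [w] is the indicator of the normal elements with the prescribed
    traces.  The sieve starts from the coset of solutions of the trace
    conditions, of size [t], and runs over the irreducible factors [p] of
    [X^m - 1] dividing no [X^(d i) - 1].  The forbidden subgroup for [p] is the
    kernel of [(X^m - 1) / p], supplemented by the kernel of [p].  The latter
    preserves the coset because [p] divides every trace polynomial. *)
Lemma normal_traces_sieve :
  exists (w : K -> algC) (theta : algC) (s t : nat),
    [/\ 0 < theta,
        (s <= size (monic_irreducible_factors f))%N,
        (q ^ m <= t * q ^ (\sum_i d i))%N,
        multiplier (2 ^+ s * theta) w /\ \sum_x w x = theta * t%:R
      & forall x, w x != 0 ->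
          normal_elt {:L}%AS x /\ forall i, trace q m (d i) x = a i].
Proof.
have m_gt0 : (0 < m)%N by rewrite adim_gt0.
have f_sep : separable_poly f by apply: separable_Xn_sub_1.
have f0 : f != 0 by apply: Xn_sub1_neq0.
have abK : abelian [set: K] by apply: FinRing.zmod_abelian.
have a_fixed i : frob_act L 'X^(d i) (a i) = a i.
  by apply/eqP; rewrite -dimE -mem_subfield_frob_act.
have [x0 x0a] := prescribed_traces_exist m_unit d_gt0 dm a_fixed a_adm.
pose V := (\bigcap_(i < k) lker (frob_act L (trace_poly F m (d i))))%VS.
have memV x : reflect (forall i, trace q m (d i) x = 0) (x \in V).
  rewrite memvE; apply: (iffP subv_bigcapP) => xV i.
    by have := xV i isT; rewrite -memvE memv_ker frob_act_trace_poly => /eqP.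
  by move=> _; rewrite -memvE memv_ker frob_act_trace_poly xV.
pose H p := vspace_group (lker (frob_act L (f %/ p))).
pose U p := vspace_group (lker (frob_act L p)).
pose js := [seq p <- monic_irreducible_factors f | [forall i, ~~ (p %| 'X^(d i) - 1)]].
have jsP p : p \in js -> [/\ p \is monic, irreducible_poly p & p %| f].
  by rewrite mem_filter => /andP[_ /(mem_monic_irreducible_factors f_sep)].
have UH : {in js, forall p, (U p * H p)%g = [set: K]}.
  move=> p /jsP[_ _ pf]; apply/eqP; rewrite eqEsubset subsetT; apply/subsetP => x _.
  have [u [v xE]] := frob_act_coprimep (x : L) (separable_coprime_cofactor f_sep pf).
  pose y : K := frob_act L v (frob_act L (f %/ p) x).
  pose z : K := frob_act L u (frob_act L p x).
  have -> : x = (y * z)%g by rewrite xE addrC.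
  rewrite mem_mulg // mem_vspace_group memv_ker.
    by rewrite frob_act_comm -(frob_actM p) mulrC divpK // frob_act_Xm_sub1 linear0.
  by rewrite frob_act_comm -(frob_actM _ p) divpK // frob_act_Xm_sub1 linear0.
have UsubH : {in js &, forall p r, p != r -> U p \subset H r}.
  move=> p r /jsP[pM pI pf] /jsP[rM rI rf] pr; apply/subsetP => x.
  rewrite 2!mem_vspace_group 2!memv_ker => /eqP px; apply/eqP.
  apply: frob_act_dvdp px.
  have cpr: coprimep p r.
    rewrite irreducible_poly_coprime //; apply: contra pr => pr.
    by apply/eqP; apply: monic_irreducible_dvdp_eq.
  by rewrite -(Gauss_dvdpl _ cpr) divpK.
pose w0 (x : K) : algC := (x * (x0 : K)^-1 \in vspace_group V)%g%:R.
have w0U p x u : p \in js -> u \in U p -> w0 (x * u)%g = w0 x.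
  move=> pjs; rewrite /w0 mem_vspace_group memv_ker => /eqP pu.
  have [_ pI pf] := jsP p pjs.
  have uV: u \in vspace_group V.
    rewrite mem_vspace_group; apply/memV => i; rewrite -frob_act_trace_poly.
    apply: frob_act_dvdp pu; have := pf; rewrite -(trace_polyM F (dm i)) Gauss_dvdpl //.
    rewrite irreducible_poly_coprime //.
    by move: pjs; rewrite mem_filter => /andP[/forallP].
  have -> : (x * u * (x0 : K)^-1 = u * (x * (x0 : K)^-1))%g.
    by rewrite mulgA; congr (_ * _)%g; apply: addrC.
  by rewrite groupMl.
have jsU : uniq js by rewrite filter_uniq // monic_irreducible_factors_uniq.
pose w (x : K) : algC := w0 x * \prod_(p <- js) (x \notin H p)%:R.
pose theta : algC := \prod_(p <- js) (1 - (#|[set: K] : H p|%g%:R)^-1).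
have [sumw multw] : \sum_x w x = theta * \sum_x w0 x
    /\ multiplier (1 * (2 ^+ size js * theta)) w.
  exact: (product_sieve abK jsU UH UsubH w0U
            (multiplier_coset abK (vspace_group V) (x0 : K))).
exists w, theta, (size js), #|vspace_group V|; split.
- rewrite /theta big_seq; apply: prodr_gt0 => p pjs.
  have [pM pI pf] := jsP p pjs.
  have p0 : p != 0 by apply: monic_neq0.
  have fp0 : f %/ p != 0 by rewrite dvdp_div_eq0.
  have [|x xN] := @frob_act_faithful F L _ fp0.
    exact: size_Xn_sub1_cofactor.
  by apply: (@avoid_density_gt0 _ (H p) x); rewrite mem_vspace_group memv_ker.
- by rewrite size_filter count_size.
- have -> : #|vspace_group V| = (q ^ \dim V)%N.
    rewrite -(card_vspace (V : {vspace finvect_type L})).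
    by apply: eq_card => x; rewrite inE.
  rewrite -expnD leq_exp2l ?finNzRing_gt1 //.
  exact: trace_kernel_dim.
- split; first by rewrite -[_ * theta]mul1r.
  rewrite sumw; congr (_ * _); rewrite (reindex_inj (mulIg (x0 : K))) /=.
  under eq_bigr => x _ do rewrite /w0 mulgK.
  by rewrite -sum1_card natr_sum [RHS]big_mkcond; apply: eq_bigr => x _; case: (_ \in _).
move=> x; rewrite /w mulf_eq0 negb_or prodf_seq_neq0 => /andP[w0x /allP wx].
have xa i : trace q m (d i) x = a i.
  have xV : x - x0 \in V.
    by move: w0x; rewrite /w0 pnatr_eq0 eqb0 negbK mem_vspace_group.
  have := memV _ xV i; rewrite -frob_act_trace_poly linearB /= !frob_act_trace_poly x0a.
  by move/eqP; rewrite subr_eq0 => /eqP.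
split=> //; apply: normal_elt_cofactors => p pM pI pf.
have [pjs|] := boolP (p \in js).
  have := wx p pjs; rewrite /= pnatr_eq0 eqb0 negbK.
  by rewrite mem_vspace_group memv_ker.
have pps : p \in monic_irreducible_factors f.
  exact/(mem_monic_irreducible_factors f_sep).
rewrite mem_filter pps andbT negb_forall => /existsP[i]; rewrite negbK => pd.
have p0 : p != 0 by apply: monic_neq0.
have d0 : 'X^(d i) - 1 != 0 :> {poly F} by apply: Xn_sub1_neq0.
(* For p dividing X^(d i) - 1 the condition at p on x is one on its trace
   a i, where it follows from the normality of a i. *)
have -> : f %/ p = ('X^(d i) - 1) %/ p * trace_poly F m (d i).
  by apply: (mulIf p0); rewrite divpK // mulrAC divpK // mulrC trace_polyM.
rewrite frob_actM frob_act_trace_poly xa (normal_elt_frob_act (a_normal i)) //.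
  by rewrite dvdp_div_eq0.
by rewrite dimE; apply: size_Xn_sub1_cofactor.
Qed.

End AdditiveSieve.

Lemma sieve_count_bound (q D Q t A B W W' : nat) :
    (1 < q)%N -> (0 < A)%N -> (0 < B)%N -> (A <= W)%N -> (B <= W')%N ->
    ((W * W') ^ 2 * q ^ (2 * D + 2) <= Q)%N -> (Q <= t * q ^ D)%N ->
  (A ^ 2 * B ^ 2 * Q < t ^ 2)%N.
Proof.
move=> q_gt1 A_gt0 B_gt0 AW BW' WQ Qt.
have qD_gt0 : (0 < q ^ (2 * D))%N by rewrite expn_gt0 ltnW.
have W_gt0 : (0 < (W * W') ^ 2)%N.
  by rewrite expn_gt0 muln_gt0 (leq_trans A_gt0 AW) (leq_trans B_gt0 BW').
have Q_gt0 : (0 < Q)%N.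
  by apply: leq_trans WQ; rewrite muln_gt0 W_gt0 expn_gt0 ltnW.
have large : ((W * W') ^ 2 * q ^ 2 * Q <= t ^ 2)%N.
  rewrite -(leq_pmul2r qD_gt0); apply: (@leq_trans (Q * Q)).
    have -> : ((W * W') ^ 2 * q ^ 2 * Q * q ^ (2 * D)
              = (W * W') ^ 2 * q ^ (2 * D + 2) * Q)%N by rewrite expnD; ring.
    by rewrite leq_pmul2r.
  have -> : (t ^ 2 * q ^ (2 * D) = (t * q ^ D) * (t * q ^ D))%N.
    by rewrite mulnC [(2 * D)%N]mulnC expnM -expnMn mulnC.
  exact: leq_mul.
apply: leq_trans large; rewrite ltn_pmul2r //.
apply: (@leq_ltn_trans ((W * W') ^ 2)).
  by rewrite -expnMn leq_exp2r // leq_mul.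
by rewrite -[X in (X < _)%N]muln1 ltn_pmul2l // -(exp1n 2) ltn_exp2r.
Qed.

Theorem theorem4p1 (R : realType) (q m k : nat)
    (F : finFieldType) (L : fieldExtType F)
    (cardF : #|F| = q) (dimL : \dim {:L} = m)
    (m_gt0 : (0 < m)%N) (coprime_mq : coprime m q)
    (k_gt1 : (1 < k)%N) (k_lt : (k < size (divisors m))%N)
    (d : 'I_k -> nat) (d_in : lambda_tuples m d)
    (* K i is the subfield of L with q ^ d i elements *)
    (K : 'I_k -> {subfield L}) (dimK : forall i, \dim (K i) = d i)
    (a : 'I_k -> L) (a_in : forall i, a i \in K i)
    (a_adm : admissible q d a) (a_normal : forall i, normal_elt (K i) (a i))
    (bound : (Wnat (q ^ m - 1) * Wpoly ('X^m - 1 : {poly F}))%N%:R <=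
             q%:R `^ (m%:R / 2%:R - (lambda_deg d)%:~R
                        - (\sum_(i < k) d i)%N%:R) :> R) :
  exists alpha : L,
    [/\ primitive_elt alpha, normal_elt {:L}%AS alpha
      & forall i, trace q m (d i) alpha = a i].
Proof.
have [d_div _ _ _] := d_in.
have d_gt0 i : (0 < d i)%N by case: (d_div i).
have dm i : (d i %| m)%N by case: (d_div i).
subst q m; set q := #|F|; set m := \dim {:L}.
have m_unit : m%:R != 0 :> F by apply: coprime_natf_neq0.
have f_sep : separable_poly ('X^m - 1 : {poly F}) by apply: separable_Xn_sub_1.
have q_gt1 : (1 < q)%N := finNzRing_gt1 F.
have [w [theta1 [s [t [theta1_gt0 s_le t_ge [mw sumw] wP]]]]] :=
  normal_traces_sieve m_unit d_gt0 dm dimK a_in a_adm a_normal.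
pose E : finFieldType := finvect_type L.
have cardE : #|E| = (q ^ m)%N := card_finvect L.
have [v [theta2 theta2_gt0 [mv sumv vP]]] :=
  @power_sieve {unit E} (cyclic_abelian (field_unit_group_cyclic _))
    (field_unit_group_cyclic _).
have nE : #|[set: {unit E}]| = (q ^ m - 1)%N.
  by rewrite card_finField_unit cardE subn1.
rewrite nE in mv.
set W := Wnat _ in bound; set W' := Wpoly _ in bound.
have W_ge : (2 ^ size (primes (q ^ m - 1)) <= W)%N.
  by apply: exp2_primes_Wnat; rewrite -nE cardG_gt0.
have W'_ge : (2 ^ s <= W')%N.
  by apply: leq_trans (exp2_factors_Wpoly f_sep); rewrite leq_exp2l.
have key := real_bound_nat q_gt1 (lambda_deg_ge1 (ltnW k_gt1) m_gt0 dm) bound.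
(* 0 is not normal, so the sum over the units loses nothing. *)
have w0 : w 0 = 0.
  apply/eqP; apply: contraTT isT => /wP[n0 _].
  have := normal_elt_frob_act n0 (oner_neq0 _); rewrite size_poly1 => /(_ m_gt0).
  by rewrite linear0 eqxx.
have sumv' : \sum_u v u = theta2 * #|{: {unit E}}|%:R by rewrite sumv cardsT.
have := sum_mixed_weights mw w0 mv sumv'; rewrite sumw.
set S := \sum_u _ => S_close.
have S_neq0 : S != 0.
  apply/eqP => S0; move: S_close; rewrite S0 sub0r normrN.
  rewrite ger0_norm; last by rewrite !mulr_ge0 ?ler0n ?ltW.
  set X := _ ^+ size _; set Y := _ ^+ s; set Z := sqrtC _.
  have -> : X * theta2 * (Y * theta1 * Z) = theta2 * (theta1 * (X * Y * Z)) by ring.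
  rewrite !ler_pM2l //.
  have Z_ge0 : 0 <= Z by rewrite sqrtC_ge0 ler0n.
  rewrite -(@ler_pXn2r _ 2) ?nnegrE ?mulr_ge0 ?exprn_ge0 ?ler0n //.
  rewrite !exprMn sqrtCK cardE /X /Y -!natrX -!natrM ler_nat leqNgt => /negP; apply.
  exact: (sieve_count_bound q_gt1 (expn_gt0 2 _) (expn_gt0 2 _) W_ge W'_ge key t_ge).
have /existsP[u uN] : [exists u, w (val u) * v u != 0].
  apply: contraNT S_neq0; rewrite negb_exists => /forallP S0.
  by apply/eqP/big1 => u _; apply/eqP; have := S0 u; rewrite negbK.
move: uN; rewrite mulf_eq0 negb_or => /andP[/wP[uN ua] /vP uG].
by exists (val u); split=> //; exists u.
Qed.
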